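(* Let $X$ be a zero-dimensional space. Then $C_c^{\psi}(X)=M_c^{\beta_0X\setminus \upsilon_0X}=O_c^{\beta_0X\setminus \upsilon_0X}$.
   Context: A zero-dimensional space is a Hausdorff topological space with a base of clopen sets. For such $X$, $C_c(X)$ is the ring of all continuous functions $f:X\to\mathbb{R}$ with countable image; $Z(f)=\{x\in X: f(x)=0\}$. The Banaschewski compactification $\beta_0X$ is the (unique up to homeomorphism) compact zero-dimensional space containing $X$ as a dense subspace such that every continuous function $X\to\{0,1\}$ extends continuously to $\beta_0X$. A space is $\mathbb{N}$-compact if it is homeomorphic to a closed subspace of $\mathbb{N}^\kappa$ for some cardinal $\kappa$ ($\mathbb{N}$ discrete). $\upsilon_0X$ is the $\mathbb{N}$-compact space containing $X$ as a dense subspace such that every continuous function $X\to\mathbb{Z}$ extends continuously to $\upsilon_0X\to\mathbb{Z}$; it is regarded as a subspace $X\subseteq\upsilon_0X\subseteq\beta_0X$, namely the set of $p\in\beta_0X$ such that the ultrafilter of clopen sets $\{U\subseteq X \text{ clopen}: p\in\mathrm{cl}_{\beta_0X}U\}$ has the countable intersection property. The support of $f\in C_c(X)$ is $\mathrm{cl}_X(X\setminus Z(f))$. A space is pseudocompact if every continuous real-valued function on it is bounded. $C_c^{\psi}(X)$ is the set of all $f\in C_c(X)$ with pseudocompact support. For $p\in\beta_0X$, $M_c^p=\{f\in C_c(X): p\in \mathrm{cl}_{\beta_0X}Z(f)\}$ and $O_c^p=\{f\in C_c(X): p\in \mathrm{int}_{\beta_0X}\mathrm{cl}_{\beta_0X}Z(f)\}$;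 for $A\subseteq\beta_0X$, $M_c^A=\bigcap_{p\in A}M_c^p$ and $O_c^A=\bigcap_{p\in A}O_c^p$ (both equal to $C_c(X)$ when $A=\emptyset$). *)

(* Defs.v *)
From HB Require Import structures.
From mathcomp Require Import all_boot all_order all_algebra.
From mathcomp Require Import all_classical all_reals all_analysis.

Set Implicit Arguments.
Unset Strict Implicit.
Unset Printing Implicit Defensive.

Import Order.TTheory GRing.Theory Num.Theory.
Import numFieldNormedType.Exports.

Local Open Scope classical_set_scope.
Local Open Scope ring_scope.

(* Not the library's [zero_dimensional], which only asks that distinct points
   be separated by clopen sets and is strictly weaker outside compact spaces. *)
Definition zero_dimensional_space (X : topologicalType) : Prop :=
  hausdorff_space X /\ exists2 B : set (set X), basis B & B `<=` clopen.

Definition topological_embedding (S T : topologicalType) (e : S -> T) : Prop :=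
  [/\ injective e, continuous e &
      forall U : set S, open U -> exists2 O : set T, open O & e @^-1` O = U].

Definition N_compact (T : topologicalType) : Prop :=
  exists (K : Type) (e : T -> {ptws K -> nat}),
    topological_embedding e /\ closed (range e).

(* [i : X -> B] exhibits [B] as the Banaschewski compactification of [X];
   the two-point discrete space is [bool]. *)
Record is_banaschewski (X B : topologicalType) (i : X -> B) : Prop := {
  bana_compact : compact [set: B] ;
  bana_zero_dimensional : zero_dimensional_space B ;
  bana_embedding : topological_embedding i ;
  bana_dense : dense (range i) ;
  bana_extension : forall f : X -> bool, continuous f ->
    exists2 g : B -> bool, continuous g & forall x, g (i x) = f x
}.

(* [V] is the copy of upsilon_0 X inside beta_0 X = [B], carrying the topology
   of the subtype [set_type V]. Density of [range i] in [V] follows from its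
   density in [B]. At most one [V] has these properties, and it consists of
   the points p for which the clopen ultrafilter
   {U | p \in closure (i @` U)} has the countable intersection property. *)
Record is_upsilon0 (X B : topologicalType) (i : X -> B) (V : set B) : Prop := {
  upsilon0_sub : range i `<=` V ;
  upsilon0_N_compact : N_compact (set_type V) ;
  upsilon0_extension : forall f : X -> discrete_topology int, continuous f ->
    exists2 g : set_type V -> discrete_topology int, continuous g &
      forall x (v : set_type V), set_val v = i x -> g v = f x
}.

Section rings_and_ideals.
Variables (R : realType) (X : topologicalType).

Definition Cc : set (X -> R) :=
  [set f | continuous f /\ countable (range f)].

Definition zero_set (f : X -> R) : set X := [set x | f x = 0].

Definition supp (f : X -> R) : set X := closure (~` zero_set f).

Definition pseudocompact (T : topologicalType) : Prop :=
  forall g : T -> R, continuous g -> bounded_fun g.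

Definition Cc_psi : set (X -> R) :=
  [set f | Cc f /\ pseudocompact (set_type (supp f))].

Variables (B : topologicalType) (i : X -> B).

Definition Mc (p : B) : set (X -> R) :=
  [set f | Cc f /\ closure (i @` zero_set f) p].

Definition Oc (p : B) : set (X -> R) :=
  [set f | Cc f /\ interior (closure (i @` zero_set f)) p].

(* Intersecting with [Cc] matters only for empty [A], where the bare
   intersection would be the set of all functions. *)
Definition Mc_on (A : set B) : set (X -> R) := Cc `&` \bigcap_(p in A) Mc p.

Definition Oc_on (A : set B) : set (X -> R) := Cc `&` \bigcap_(p in A) Oc p.

End rings_and_ideals.
Arguments Cc_psi : clear implicits.
Arguments Mc_on R {X B} i A.
Arguments Oc_on R {X B} i A.

(* Main.v *)
Require Import Defs.
From HB Require Import structures.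
From mathcomp Require Import all_boot all_order all_algebra.
From mathcomp Require Import all_classical all_reals all_analysis.

(** The bridge between the three sets is the notion of a vanishing sequence: a
    decreasing sequence of clopen subsets of X with empty intersection. Since a
    clopen U of X has a clopen closure in beta_0 X, the points of beta_0 X are
    ultrafilters of clopen sets, and a point lies outside upsilon_0 X exactly
    when it lies in the closure of every term of some vanishing sequence
    ([vanishing_misses_upsilon0], [upsilon0_complete]). Vanishing sequences
    also detect pseudocompactness: the level function of such a sequence is
    continuous, so on a pseudocompact set it is bounded and the sequence is
    eventually disjoint from that set ([pseudocompact_vanishing]); conversely,
    an unbounded continuous function on the closure of an open set C yields a
    vanishing sequence of nonempty subsets of C
    ([not_pseudocompact_vanishing]).

    The theorem is the cycle psi <= O <= M <= psi. If f has pseudocompact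
    support and p is outside upsilon_0 X, some term of the vanishing sequence
    attached to p misses the support, hence lies in Z(f), and its closure is
    an open neighbourhood of p inside the closure of Z(f). The inclusion O <= M
    is formal. If the support of f is not pseudocompact, there is a vanishing
    sequence of nonempty sets inside the cozero set of f; by compactness the
    closures of its terms have a common point p, which is outside
    upsilon_0 X, and p is not in the closure of Z(f) because the first term is
    a clopen set disjoint from Z(f). *)

Set Implicit Arguments.
Unset Strict Implicit.
Unset Printing Implicit Defensive.

Import Order.TTheory GRing.Theory Num.Theory.
Import numFieldNormedType.Exports.
Local Open Scope classical_set_scope.
Local Open Scope ring_scope.

(** * Vanishing sequences of clopen sets *)

Lemma locally_constant_continuous (T U : topologicalType) (f : T -> U) :
  (forall x, \forall y \near x, f y = f x) -> continuous f.
Proof.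
by move=> floc x; exact: (@near_cst_continuous T U (f x) f x (floc x)).
Qed.

(** A clopen ultrafilter fails the countable intersection property exactly when
    it contains all terms of such a sequence: replace countably many members
    with empty intersection by their finite intersections. *)
Definition vanishing (X : topologicalType) (E : nat -> set X) : Prop :=
  [/\ forall n, clopen (E n), forall n, E n.+1 `<=` E n & \bigcap_n E n = set0].

(** Counting the terms that contain x gives a finite number because the
    intersection is empty. Local constancy is recorded rather than continuity,
    so that composing with any map from nat to the integers, the reals or a
    discrete space gives a continuous function at once. *)
Lemma level_function (X : topologicalType) (E : nat -> set X) :
  vanishing E -> exists h : X -> nat,
    (forall x, \forall y \near x, h y = h x) /\
    forall n, E n = [set x | (n < h x)%N].
Proof.
move=> [Eclopen Edecr Ecap].
have Emono m n : (m <= n)%N -> E n `<=` E m.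
  elim: n => [|n IH]; first by rewrite leqn0 => /eqP ->.
  rewrite leq_eqVlt => /orP[/eqP -> //|]; rewrite ltnS => mn x /Edecr.
  exact: IH.
have out x : exists n, `[< ~ E n x >].
  apply: contrapT => allE; suff: (\bigcap_n E n) x by rewrite Ecap.
  by move=> n _; apply: contrapT => nE; apply: allE; exists n; apply/asboolP.
pose h x := ex_minn (out x).
have EE n : E n = [set x | (n < h x)%N].
  apply/seteqP; split=> x; rewrite /= /h; case: ex_minnP => m /asboolP nE least.
    by move=> En; rewrite ltnNge; apply/negP => /Emono /(_ _ En).
  move=> nm; apply: contrapT => nEn.
  by have := least n; rewrite leqNgt nm => /(_ (asboolT nEn)).
exists h; split=> // x.
have upper : \forall y \near x, (h y <= h x)%N.
  have : nbhs x (~` E (h x)).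
    apply: open_nbhs_nbhs; split; last by rewrite EE /= ltnn.
    by apply: closed_openC; case: (Eclopen (h x)).
  by apply: filterS => y; rewrite EE /= => /negP; rewrite -leqNgt.
have lower : \forall y \near x, (h x <= h y)%N.
  case hx : (h x) => [|k]; first exact: nearW.
  have : nbhs x (E k).
    by apply: open_nbhs_nbhs; split; [case: (Eclopen k) | rewrite EE /= hx].
  by apply: filterS => y; rewrite EE.
by near=> y; apply/eqP; rewrite eqn_leq; apply/andP; split; near: y.
Unshelve. all: by end_near.
Qed.

(** * The compactification and upsilon_0 *)

Lemma nbhs_coordinate (K : Type) (f : {ptws K -> nat}) (k : K) :
  nbhs f [set g | g k = f k].
Proof.
have ff : nbhs f --> f by [].
apply: ((cvg_sup _ _ (nbhs_filter f)).1 ff k).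
exists [set g | g k = f k] => //; split=> //.
by exists [set f k] => //; exact: discrete_open.
Qed.

Section banaschewski.
Variables (X B : topologicalType) (i : X -> B).
Hypothesis beta : is_banaschewski i.

Lemma nbhs_meets_image (p : B) (O : set B) : nbhs p O -> exists x, O (i x).
Proof.
rewrite nbhsE => -[W [Wo Wp] WO].
have [|w [Ww [x _ eqw]]] := bana_dense beta _ Wo; first by exists p.
by exists x; apply: WO; rewrite eqw.
Qed.

(** The indicator of U extends to a two-valued function g on the
    compactification; by density the closure of U is the set where g is true. *)
Lemma clopen_closure_image (U : set X) :
  clopen U -> clopen (closure (i @` U)) /\ i @^-1` closure (i @` U) = U.
Proof.
move=> [Uo Uc].
have [|g gc gE] := bana_extension beta (f := fun x => `[< U x >]).
  apply: locally_constant_continuous => x.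
  have [Ux|nUx] := pselect (U x).
    have : nbhs x U by apply: open_nbhs_nbhs.
    by apply: filterS => y Uy; rewrite !asboolT.
  have : nbhs x (~` U) by apply: open_nbhs_nbhs; split=> //; exact: closed_openC.
  by apply: filterS => y Uy; rewrite !asboolF.
have gclopen : clopen (g @^-1` [set true]).
  by apply: preimage_clopen => //; split;
    [exact: discrete_open | exact: discrete_closed].
have -> : closure (i @` U) = g @^-1` [set true].
  apply/seteqP; split=> p.
    case: gclopen => _ + pU; apply; apply: closureS pU => _ [x Ux <-].
    by rewrite /= gE asboolT.
  move=> gp N Np.
  have : nbhs p (N `&` (g @^-1` [set true])).
    by apply: filterI => //; apply: open_nbhs_nbhs; case: gclopen.
  move=> /nbhs_meets_image [x [Nx gx]]; exists (i x); split=> //.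
  by exists x => //; apply/asboolP; rewrite -gE.
by split=> //; apply/seteqP; split=> x; rewrite /= gE => /asboolP.
Qed.

Lemma closure_clopen_disjoint (U Z : set X) (p : B) : clopen U ->
  Z `&` U = set0 -> closure (i @` U) p -> closure (i @` Z) p -> False.
Proof.
move=> Uclopen ZU pU pZ.
have [[Wo _] Weq] := clopen_closure_image Uclopen.
have [|_ [ [x Zx <-] Wx]] := pZ (closure (i @` U)).
  by apply: open_nbhs_nbhs.
by have : (Z `&` U) x; [split=> //; rewrite -Weq | rewrite ZU].
Qed.

Section upsilon.
Variable V : set B.
Hypothesis upsilon : is_upsilon0 i V.

Let into (x : X) : set_type V :=
  SigSub (mem_set (upsilon0_sub upsilon (imageT i x))).

Let into_continuous : continuous into.
Proof.
move=> x A [_ [[W Wo <-] Ox] OA].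
have [_ ic _] := bana_embedding beta.
have iW : nbhs x (i @^-1` W) by apply: ic; exact: open_nbhs_nbhs.
suff : nbhs x (into @^-1` A) by [].
by apply: filterS iW => y Wy; exact: (OA (into y)) Wy.
Qed.

(** The level function extends to an integer-valued g on upsilon_0 X. Near p
    that extension is constant, so points of X near p all have the same level
    and cannot enter the later terms of the sequence. *)
Lemma vanishing_misses_upsilon0 (E : nat -> set X) (p : B) :
  vanishing E -> V p -> exists n, ~ closure (i @` E n) p.
Proof.
move=> Ev Vp; have [h [hloc hE]] := level_function Ev.
have [|g gc gE] := upsilon0_extension upsilon (f := fun x => Posz (h x)).
  apply: locally_constant_continuous => x.
  by apply: filterS (hloc x) => y ->.
pose v : set_type V := SigSub (mem_set Vp).
have : nbhs v (g @^-1` [set g v]).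
  by apply: gc; exact: (@discrete_set1 (discrete_topology int)).
move=> [_ [[W Wo <-] Ov] Og].
have nbhsO : nbhs p W by apply: open_nbhs_nbhs.
exists (absz (g v)) => pE.
have [_ [ [x Ex <-] Ox]] := pE W nbhsO.
have /= := Og (into x) Ox; rewrite (gE x) // => eq_gv.
by move: Ex; rewrite hE -eq_gv /= ltnn.
Qed.

(** If no vanishing sequence clusters at p, then along the trace on X of the
    neighbourhoods of p each natural-valued coordinate of the N-compact
    embedding e of upsilon_0 X is eventually constant. So e converges along
    this filter, its limit is e v for some v because the range of e is closed,
    and the trace filter converges both to p and to v. *)
Lemma upsilon0_complete (p : B) : ~ V p ->
  exists2 E, vanishing E & forall n, closure (i @` E n) p.
Proof.
move=> nVp; apply: contrapT => noE.
have [K [e [[_ ec eO] eclosed]]] := upsilon0_N_compact upsilon.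
pose h k x := e (into x) k.
have ek_loc k (v : set_type V) : \forall w \near v, e w k = e v k.
  exact: (ec v _ (nbhs_coordinate (e v) k)).
have h_loc k x : \forall y \near x, h k y = h k x.
  exact: into_continuous (ek_loc k (into x)).
have h_clopen k (A : set nat) : clopen (h k @^-1` A).
  have hc : continuous (h k) by exact: locally_constant_continuous.
  by apply: preimage_clopen => //; split;
    [exact: discrete_open | exact: discrete_closed].
(* Otherwise the tails of the k-th coordinate would form a vanishing sequence
   all of whose closures contain p. *)
have tail k : exists n, ~ closure (i @` [set x | (n <= h k x)%N]) p.
  apply: contrapT => allp; apply: noE.
  exists (fun n => [set x | (n <= h k x)%N]); last first.
    by move=> n; apply: contrapT => np; apply: allp; exists n.
  split.
  - by move=> n; exact: (h_clopen k [set m | (n <= m)%N]).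
  - by move=> n x /= /ltnW.
  - by rewrite -subset0 => x /(_ (h k x).+1 I) /=; rewrite ltnn.
(* If n is least such that p leaves the closure of the tail of index n, then
   n > 0 by density, and the k-th coordinate takes the value n - 1 near p. *)
have value k : exists n, closure (i @` [set x | h k x = n]) p.
  have [n + least] := ex_minnP (let: ex_intro n np := tail k in
    ex_intro (fun n => `[< ~ closure (i @` [set x | (n <= h k x)%N]) p >]) n
      (asboolT np)).
  case: n least => [|n] least /asboolP nclos.
    exfalso; apply: nclos => N /nbhs_meets_image [x Nx].
    by exists (i x); split=> //; exists x.
  exists n.
  have : closure (i @` [set x | (n <= h k x)%N]) p.
    apply: contrapT => np.
    by have := least n (asboolT np); rewrite ltnn.
  have -> : [set x | (n <= h k x)%N] =
      [set x | h k x = n] `|` [set x | (n < h k x)%N].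
    apply/seteqP; split=> x /=; last by move=> [-> //|/ltnW].
    by rewrite leq_eqVlt => /orP[/eqP <-|]; [left | right].
  by rewrite image_setU closureU => -[].
have [a aP] := choice value.
pose F : set_system X := filter_from (nbhs p) (fun N => i @^-1` N).
have FF : ProperFilter F.
  apply: filter_from_proper; last by move=> N /nbhs_meets_image.
  apply: filter_from_filter; first by exists setT; exact: filterT.
  by move=> N N' pN pN'; exists (N `&` N') => //; exact: filterI.
have iF : i @ F --> p by move=> N pN; exists N.
have Fa k : F [set x | h k x = a k].
  have [[Wo _] Weq] := clopen_closure_image (h_clopen k [set a k]).
  exists (closure (i @` (h k @^-1` [set a k]))); last by rewrite Weq.
  by apply: open_nbhs_nbhs; split=> //; exact: aP.
have eF : (e \o into) @ F --> (a : {ptws K -> nat}).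
  apply/cvg_sup => k A [_ [ [C Co <-] Ca] CA].
  apply: filterS (Fa k) => x hx; apply: CA => /=.
  by rewrite -[e (into x) k]/(h k x) hx.
have [v _ va] : range e a.
  apply: (closed_cvg (range e) eclosed _ _ eF).
  by apply: nearW => x; exists (into x).
have intoF : i @ F --> set_val v.
  move=> N vN.
  have : nbhs v (set_val @^-1` N) by exact: initial_continuous vN.
  rewrite nbhsE => -[U [Uo Uv] UN].
  have [W Wo WU] := eO U Uo.
  have FW : F ((e \o into) @^-1` W).
    apply: eF; apply: open_nbhs_nbhs; split=> //.
    by rewrite -va; move: Uv; rewrite -WU.
  suff : F (i @^-1` N) by [].
  by apply: filterS FW => x Wx; apply: (UN (into x)); rewrite -WU.
have [Bhaus _] := bana_zero_dimensional beta.
by apply: nVp; rewrite (cvg_unique Bhaus iF intoF); exact: set_valP.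
Qed.

End upsilon.

Lemma compact_nested_closures (E : nat -> set X) :
  (forall n, E n.+1 `<=` E n) -> (forall n, E n !=set0) ->
  exists p, forall n, closure (i @` E n) p.
Proof.
move=> Edecr Ene; have [x xE] := choice Ene.
have [|p [_ pcl]] := @bana_compact _ _ _ beta ((i \o x) @ \oo) _.
  exact: filterT.
exists p => n N pN.
apply: pcl => //; exists n => // m /= nm; exists (x m) => //.
suff sub k : E (n + k)%N `<=` E n by apply: (sub (m - n)%N); rewrite subnKC.
by elim: k => [|k IH] y; rewrite ?addn0 // addnS => /Edecr /IH.
Qed.

End banaschewski.

(** * Pseudocompactness *)

Lemma pseudocompact_vanishing (R : realType) (X : topologicalType) (S : set X)
    (E : nat -> set X) :
  pseudocompact R (set_type S) -> vanishing E -> exists n, S `&` E n = set0.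
Proof.
move=> Spc /level_function [h [hloc hE]].
have [|M [_ /(_ (M + 1))]] := Spc (fun s => (h (set_val s))%:R : R).
  apply: locally_constant_continuous => s.
  have near_s : nbhs s (set_val @^-1` [set y | h y = h (set_val s)]).
    by apply: initial_continuous; exact: hloc.
  by apply: filterS near_s => t /= ->.
rewrite ltrDl ltr01 => /(_ isT) Mbound.
exists (Num.bound `|M + 1|); rewrite -subset0 hE => x [Sx /= Mx].
have := Mbound (SigSub (mem_set Sx)) I; rewrite /= ger0_norm //.
apply/negP; rewrite -ltNge (le_lt_trans (ler_norm _)) //.
by rewrite (lt_trans (archi_boundP (normr_ge0 _))) // ltr_nat.
Qed.

(** Let g be unbounded and continuous on the closure of C. By density of C in
    its closure and zero-dimensionality, choose for each m a nonempty clopen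
    U m inside C on which |g| > m. As g is locally bounded, the family U is
    locally finite, so the unions of its tails are clopen; they have empty
    intersection because |g| is finite at each point. *)
Lemma not_pseudocompact_vanishing (R : realType) (X : topologicalType)
    (C : set X) : zero_dimensional_space X -> open C ->
  ~ pseudocompact R (set_type (closure C)) ->
  exists2 E, vanishing E & forall n, E n !=set0 /\ E n `<=` C.
Proof.
move=> [_ [Bs [_ Bbase] Bclopen]] Co.
move=> /existsNP [g /not_implyP [gc gub]].
have large n : exists s, n%:R < `|g s|.
  apply: contrapT => small; apply: gub; exists n%:R; split; first exact: num_real.
  move=> M nM s _ /=; apply: le_trans (ltW nM).
  by rewrite leNgt; apply/negP => ns; apply: small; exists s.
have ngc : continuous (fun s => `|g s|).
  by move=> s; apply: continuous_comp; [exact: gc | exact: norm_continuous].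
have : forall n, exists U : set X, [/\ clopen U, U !=set0, U `<=` C &
    forall s : set_type (closure C), U (set_val s) -> n%:R < `|g s|].
  move=> n; have [s sn] := large n.
  have : nbhs s [set t | n%:R < `|g t|] by exact: (ngc s _ (lt_nbhsr sn)).
  move=> [_ [[W Wo <-] Os] On].
  have [x [Cx Ox]] : C `&` W !=set0.
    by apply: (set_valP s); apply: open_nbhs_nbhs.
  have : nbhs x (C `&` W) by apply: open_nbhs_nbhs; split=> //; exact: openI.
  move=> /Bbase [U [BU Ux] UCO]; exists U; split.
  - exact: Bclopen.
  - by exists x.
  - by move=> y /UCO [].
  - by move=> t /UCO [_ Ot]; apply: On.
move=> /choice [U UP].
have subC n x : U n x -> C x by have [_ _ + _] := UP n; apply.
exists (fun n => \bigcup_(m in [set m | (n <= m)%N]) U m); last first.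
  move=> n; split; last by move=> x [m _ /subC].
  by have [_ [x Ux] _ _] := UP n; exists x, n => /=.
have value n x (Cx : closure C x) : U n x ->
    n%:R < `|g (SigSub (mem_set Cx))|.
  by have [_ _ _ large_n] := UP n; exact: (large_n (SigSub (mem_set Cx))).
split.
- move=> n; split.
    by apply: bigcup_open => m _; have [[]] := UP m.
  rewrite -openC openE => y ny.
  have [Cy|nCy] := pselect (closure C y); last first.
    have : nbhs y (~` closure C).
      by apply: open_nbhs_nbhs; split=> //; exact/closed_openC/closed_closure.
    apply: filterS => z nCz [m _ /subC Cz].
    by apply: nCz; exact: subset_closure.
  pose s : set_type (closure C) := SigSub (mem_set Cy).
  pose k := Num.bound `|g s|.
  have : nbhs s [set t | `|g t| < k%:R].
    by exact: (ngc s _ (lt_nbhsl (archi_boundP (normr_ge0 _)))).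
  move=> [_ [[W Wo <-] Os] Ok].
  have nbhsO : nbhs y W by apply: open_nbhs_nbhs.
  (* Near y, |g| stays below k, so only the sets U m with m < k can come close
     to y. *)
  have : nbhs y (~` \bigcup_(m in [set m | (n <= m < k)%N]) U m).
    apply: open_nbhs_nbhs; split; last first.
      by move=> [m /andP[nm _] Um]; apply: ny; exists m.
    apply: closed_openC; apply: closed_bigcup.
      apply: (sub_finite_set _ (finite_II k)) => m /andP[_]; exact.
    by move=> m _; have [[]] := UP m.
  apply: filterS2 nbhsO => z Oz nz [m nm Um]; apply: nz; exists m => //=.
  rewrite nm /=; have Cz := subset_closure (subC _ _ Um).
  rewrite -(ltr_nat R) (lt_trans (value _ _ Cz Um)) //.
  exact: Ok.
- by move=> n x [m nm Um]; exists m => //; exact: ltnW.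
- rewrite -subset0 => x inall.
  have [m0 _ /subC /subset_closure Cx] := inall 0%N I.
  pose s : set_type (closure C) := SigSub (mem_set Cx).
  have [m /= km Um] := inall (Num.bound `|g s|) I.
  have := value _ _ Cx Um; apply/negP; rewrite -leNgt.
  by rewrite (le_trans (ltW (archi_boundP (normr_ge0 _)))) // ler_nat.
Qed.

Lemma open_cozero (R : realType) (X : topologicalType) (f : X -> R) :
  continuous f -> open (~` zero_set f).
Proof.
by move=> fc; apply: closed_openC; exact: (preimage_closed (D := [set 0])).
Qed.

(** * The theorem *)

Theorem theorem2p12 (R : realType) (X B : topologicalType) (i : X -> B)
    (V : set B) (X_zero_dim : zero_dimensional_space X)
    (beta0X : is_banaschewski i) (upsilon0X : is_upsilon0 i V) :
  Cc_psi R X = Mc_on R i (~` V) /\ Mc_on R i (~` V) = Oc_on R i (~` V).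
Proof.
have psiO : Cc_psi R X `<=` Oc_on R i (~` V).
  move=> f [fC fpc]; split=> // p nVp; split=> //.
  have [E Ev pE] := upsilon0_complete beta0X upsilon0X nVp.
  have [n SE] := pseudocompact_vanishing fpc Ev.
  have [En _ _] := Ev.
  have [[Wo _] _] := clopen_closure_image beta0X (En n).
  have : nbhs p (closure (i @` E n)) by apply: open_nbhs_nbhs.
  apply: filterS; apply: closureS; apply: image_subset => x Ex.
  apply: contrapT => nzx; suff : (supp f `&` E n) x by rewrite SE.
  by split=> //; exact: subset_closure.
have OM : Oc_on R i (~` V) `<=` Mc_on R i (~` V).
  move=> f [fC fO]; split=> // p nVp; split=> //.
  by have [_ /interior_subset] := fO p nVp.
have Mpsi : Mc_on R i (~` V) `<=` Cc_psi R X.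
  move=> f [fC fM]; split=> //; apply: contrapT => npc.
  have [fc _] := fC.
  have [E Ev EP] := not_pseudocompact_vanishing X_zero_dim (open_cozero fc) npc.
  have [En Edecr _] := Ev.
  have [p pE] := compact_nested_closures beta0X Edecr (fun n => (EP n).1).
  have nVp : (~` V) p.
    by move=> /(vanishing_misses_upsilon0 upsilon0X Ev) [n]; apply.
  have [_ pZ] := fM p nVp.
  apply: (closure_clopen_disjoint beta0X (En 0%N) _ (pE 0%N) pZ).
  by rewrite -subset0 => x [zx /(EP 0%N).2].
split; apply/seteqP; split=> //; first exact: subset_trans psiO OM.
exact: subset_trans Mpsi psiO.
Qed.
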